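(* Let $\Omega\subset\mathbb{R}^2$ be a connected domain with piecewise smooth boundary, and let $\Omega_{rect}^{(low)}$ be the maximal rectangle that is a subset of $\Omega$. Let $v^{(1)}(x,y,t)$ satisfy $$v^{(1)}_t=\Delta v^{(1)}+f(v^{(1)}),\quad (x,y)\in\Omega_{rect}^{(low)},\ t>0,$$ $$v^{(1)}=0,\quad (x,y)\in\partial\Omega_{rect}^{(low)},\ t>0,$$ $$v^{(1)}=0,\quad (x,y)\in\overline{\Omega}_{rect}^{(low)},\ t=0.$$ Define $$v(x,y,t)=\begin{cases} v^{(1)}(x,y,t), & (x,y)\in\Omega_{rect}^{(low)},\ t\ge 0,\\ 0, & (x,y)\in\overline{\Omega}\setminus\Omega_{rect}^{(low)},\ t\ge 0.\end{cases}$$ Then $v$ is a lower solution.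
   Context: The underlying problem is a quenching reaction-diffusion equation on $\Omega$ with reactive term $f(u)$ and Dirichlet boundary conditions. The function $f$ is nonlinear, positive and strictly increasing for $0\le u<1$, and $f(u)\to\infty$ as $u\to1^-$ (in particular $f(0)>0$). A lower solution is a function $v(x,y,t)$ that satisfies $v_t\le\Delta v+f(v)$ for $(x,y)\in\Omega$, $t>0$; $v\le 0$ for $(x,y)\in\partial\Omega$, $t>0$; and $v\le0$ for $(x,y)\in\overline{\Omega}$, $t=0$.
   Formalization: Where the Laplacian of v fails to exist (sides of the rectangle inside Ω), it is read as the sum of lower limits of symmetric second differences in x and y, with values in [-∞,∞]; solutions are continuous up to the boundary with values in [0,1), where f is given. *)

(* Defs.v *)
From HB Require Import structures.
From mathcomp Require Import all_boot all_order all_algebra.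
From mathcomp Require Import all_classical all_reals all_analysis.
From mathcomp Require Import ring lra.

Set Implicit Arguments.
Unset Strict Implicit.
Unset Printing Implicit Defensive.

Import Order.TTheory GRing.Theory Num.Theory.
Import numFieldNormedType.Exports.

Local Open Scope ring_scope.
Local Open Scope classical_set_scope.

(* In ring_scope these notations otherwise denote polynomial derivatives. *)
Local Notation "f ^` ()" := (derive1 f) : ring_scope.
Local Notation "f ^` ( n )" := (derive1n n f) : ring_scope.

Section Geometry.
Context {R : realType}.
Implicit Types (A Om : set (R * R)).

Definition boundary A : set (R * R) := closure A `\` A°.

(* A regular C^1 arc; asking for derivatives on the whole line is harmless,
   since a C^1 arc on [0, 1] extends affinely beyond its end points. *)
Definition regular_arc (g : R -> R * R) : Prop :=
  let g1 := fst \o g in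
  let g2 := snd \o g in
  [/\ forall s, derivable g1 s 1 /\ derivable g2 s 1,
      continuous (g1^`()) /\ continuous (g2^`()) &
      forall s, 0 <= s <= 1 -> (g1^`() s, g2^`() s) <> (0, 0)].

(* Near each of its points the boundary is a finite union of regular C^1 arcs;
   the local form also covers unbounded domains. *)
Definition piecewise_smooth_boundary Om : Prop :=
  forall p, boundary Om p -> exists (U : set (R * R)) (gs : seq (R -> R * R)),
    [/\ open U, U p, forall g, List.In g gs -> regular_arc g &
        boundary Om `&` U =
        [set q | exists2 g, List.In g gs & (g @` `[0, 1]) q] `&` U].

Definition domain Om : Prop := [/\ open Om, connected Om & Om !=set0].

(* The open rectangle with centre c, half-sides a and b, and the side of
   half-length a making the angle th with the x-axis. *)
Definition rectangle (c : R * R) (th a b : R) : set (R * R) :=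
  [set p | `|cos th * (p.1 - c.1) + sin th * (p.2 - c.2)| < a /\
           `|cos th * (p.2 - c.2) - sin th * (p.1 - c.1)| < b].

(* Maximality is with respect to inclusion, among the rectangles with sides
   parallel to those of A. A rectangle of largest area, either among all the
   rectangles in Om or among those of a prescribed orientation, is maximal in
   this sense. *)
Definition maximal_rectangle Om A : Prop :=
  exists c th a b,
    [/\ 0 < a, 0 < b, A = rectangle c th a b, A `<=` Om &
        forall c' a' b', 0 < a' -> 0 < b' ->
          A `<=` rectangle c' th a' b' -> rectangle c' th a' b' `<=` Om ->
          rectangle c' th a' b' = A].

End Geometry.

Section Calculus.
Context {R : realType}.
Implicit Types (g : R -> R) (v : R -> R -> R -> R).

Definition twice_derivable g (x : R) : Prop :=
  (\forall s \near x, derivable g s 1) /\ derivable (g^`()) x 1.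

(* The lower symmetric second derivative. It is +oo at a convex kink and -oo at
   a concave one, and is the usual second derivative wherever the latter exists
   (lemma lower_derive2E). *)
Definition lower_derive2 g (x : R) : \bar R :=
  lime_inf (fun h => ((g (x + h) + g (x - h) - 2 * g x) / h ^+ 2)%:E) 0.

Definition d_t v (x y t : R) : R := (fun s => v x y s)^`() t.

Definition laplacian v (x y t : R) : R :=
  (fun s => v s y t)^`(2) x + (fun s => v x s t)^`(2) y.

(* Here +oo + -oo = -oo, which is the unfavourable value for lower solutions. *)
Definition lower_laplacian v (x y t : R) : \bar R :=
  (lower_derive2 (fun s => v s y t) x + lower_derive2 (fun s => v x s t) y)%E.

Lemma twice_derivable_symm g x : twice_derivable g x ->
  forall e, 0 < e -> exists2 d, 0 < d & forall h, 0 < h < d ->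
    `|g (x + h) + g (x - h) - 2 * g x - g^`(2) x * h ^+ 2| <= e * h ^+ 2.
Proof.
move=> [gx1 gx2] e e0.
have e20 : 0 < e / 2 by rewrite divr_gt0.
have : h^-1 *: (g^`() (h *: 1 + x) - g^`() x) @[h --> 0^'] --> g^`(2) x.
  by rewrite [g^`(2) x]derive1E; exact: gx2.
move/cvgrPdist_le => /(_ _ e20).
pose L : R := g^`(2) x; rewrite -/L.
move=> [d1/= d10 Hd1]; case: gx1 => d2/= d20 Hd2.
exists (Num.min d1 d2); first by rewrite lt_min d10 d20.
move=> h /andP[h0]; rewrite lt_min => /andP[hd1 hd2].
have dg k : `|k| <= h -> derivable g (x + k) 1.
  move=> kh; apply: Hd2 => /=; rewrite opprD addNKr normrN.
  exact: le_lt_trans hd2.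
have est k : 0 < `|k| <= h -> `|g^`() (x + k) - g^`() x - L * k| <= e / 2 * `|k|.
  move=> /andP[k0 kh].
  have kn0 : k != 0 by rewrite -normr_gt0.
  have := Hd1 k; rewrite /= sub0r normrN => /(_ (le_lt_trans kh hd1) kn0).
  rewrite [k *: 1]mulr1 [k + x]addrC => H.
  have -> : g^`() (x + k) - g^`() x - L * k =
      - ((L - k^-1 *: (g^`() (x + k) - g^`() x)) * k).
    by rewrite /GRing.scale/=; field.
  by rewrite normrN normrM ler_pM2r.
pose F (k : R) : R := g (x + k) + g (x - k) - L * k ^+ 2.
pose dF (k : R) : R := g^`() (x + k) - g^`() (x - k) - L * (2 * k).
have isF (k : R) : `|k| <= h -> is_derive k 1 F (dF k).
  move=> kh.
  have p1 : is_derive (x + k) 1 g (g^`() (x + k)).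
    by rewrite derive1E; apply/derivableP/dg.
  have p2 : is_derive (x - k) 1 g (g^`() (x - k)).
    by rewrite derive1E; apply/derivableP/dg; rewrite normrN.
  have q1 : is_derive k 1 (fun s => x + s) 1.
    by apply: is_derive_eq; rewrite /GRing.scale/=; ring.
  have q2 : is_derive k 1 (fun s => x - s) (-1).
    by apply: is_derive_eq; rewrite /GRing.scale/=; ring.
  have r1 : is_derive k 1 (g \o (fun s => x + s)) (g^`() (x + k) * 1).
    exact: is_derive1_comp.
  have r2 : is_derive k 1 (g \o (fun s => x - s)) (g^`() (x - k) * -1).
    exact: is_derive1_comp.
  have r3 : is_derive k 1 (fun s : R => L * s ^+ 2) (L * (2 * k)).
    apply: is_derive_eq.
    by rewrite /GRing.scale/=; ring.
  rewrite (_ : F = (g \o (fun s => x + s)) \+ (g \o (fun s => x - s)) \-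
                   (fun s : R => L * s ^+ 2)) //.
  apply: is_derive_eq.
  by rewrite /dF mulr1 mulrN1.
have [||c cI] := @MVT R F dF 0 h h0.
- move=> k; rewrite in_itv/= => /andP[k0 kh]; apply: isF.
  by rewrite gtr0_norm// ltW.
- apply: derivable_within_continuous => k; rewrite in_itv/= => /andP[k0 kh].
  by have [] := isF k _; rewrite ?ger0_norm.
move: cI; rewrite in_itv/= => /andP[c0 ch].
rewrite /F addr0 subr0 expr0n/= mulr0 !subr0 => E.
rewrite (_ : _ - _ = dF c * h); last by rewrite -E; ring.
have H1 := est c; have H2 := est (- c).
rewrite normrN gtr0_norm// c0 (ltW ch)/= in H1 H2.
move: (H1 isT) (H2 isT) => {}H1 {}H2.
have dFc : `|dF c| <= e * c.
  rewrite (_ : dF c = (g^`() (x + c) - g^`() x - L * c) -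
                      (g^`() (x - c) - g^`() x - L * - c)); last first.
    by rewrite /dF; ring.
  rewrite (le_trans (ler_normB _ _))// (le_trans (lerD H1 H2))//.
  by rewrite -mulrDl -splitr.
rewrite normrM (gtr0_norm h0) expr2 mulrA ler_pM2r//.
by rewrite (le_trans dFc)// ler_pM2l// ltW.
Qed.

Lemma lower_derive2E g x :
  twice_derivable g x -> lower_derive2 g x = (g^`(2) x)%:E.
Proof.
move=> /twice_derivable_symm symm; set L := g^`(2) x.
pose q h := (g (x + h) + g (x - h) - 2 * g x) / h ^+ 2.
have qL e : 0 < e -> exists2 d, 0 < d & forall h, h != 0 -> `|h| < d ->
    `|q h - L| <= e.
  move=> e0; have [d d0 dP] := symm e e0; exists d => // h h0 hd.
  have h20 : 0 < h ^+ 2 by rewrite exprn_even_gt0.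
  have := dP `|h|; rewrite normr_gt0 h0 hd real_normK ?num_real// => /(_ isT).
  have -> : g (x + `|h|) + g (x - `|h|) = g (x + h) + g (x - h).
    by case: (ger0P h) => // _; rewrite opprK addrC.
  move=> H; rewrite -(ler_pM2r h20) -{1}(gtr0_norm h20) -normrM mulrBl.
  by rewrite /q divfK// gt_eqF.
have -> : lower_derive2 g x = limf_einf (EFin \o q) (0 : R)^' by [].
rewrite limf_einfE; apply/eqP; rewrite eq_le; apply/andP; split.
- apply: ge_ereal_sup => _ [V V0 <-]; apply/lee_addgt0Pr => e e0.
  have [d d0 dP] := qL e e0; move: V0 => [d'/= d'0 VP].
  pose h := Num.min d d' / 2.
  have m0 : 0 < Num.min d d' by rewrite lt_min d0 d'0.
  have h0 : 0 < h by rewrite divr_gt0.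
  have hm : h < Num.min d d' by rewrite /h ltr_pdivrMr// ltr_pMr// ltr1n.
  move: (hm); rewrite lt_min => /andP[hd hd'].
  have Vh : V h.
    by apply: VP; [rewrite /= sub0r normrN gtr0_norm|rewrite gt_eqF].
  apply: (@le_trans _ _ (q h)%:E); first by apply: ereal_inf_lbound; exists h.
  rewrite -EFinD lee_fin.
  have := dP h; rewrite gt_eqF// gtr0_norm// => /(_ isT hd).
  by rewrite ler_distl => /andP[].
- apply/lee_subgt0Pr => e e0; have [d d0 dP] := qL e e0.
  apply: (@le_trans _ _
    (ereal_inf ((EFin \o q) @` [set h | h != 0 /\ `|h| < d]))).
    apply: le_ereal_inf_tmp => _ [h [h0 hd] <-].
    rewrite -EFinB lee_fin; have := dP h h0 hd.
    by rewrite ler_distl => /andP[].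
  apply: ereal_sup_ubound; exists [set h | h != 0 /\ `|h| < d] => //.
  exists d => //= h; rewrite /= sub0r normrN => hd h0.
  by split.
Qed.

Lemma lower_laplacianE v x y t :
  twice_derivable (fun s => v s y t) x -> twice_derivable (fun s => v x s t) y ->
  lower_laplacian v x y t = (laplacian v x y t)%:E.
Proof. by move=> hx hy; rewrite /lower_laplacian !lower_derive2E. Qed.

End Calculus.

Section Problem.
Context {R : realType}.
Implicit Types (f : R -> R) (D Om : set (R * R)) (v : R -> R -> R -> R).

(* The reaction term is a function on [0, 1); the values of f elsewhere are
   never used. *)
Definition reaction_term f : Prop :=
  [/\ ~ (exists a b, forall u, 0 <= u < 1 -> f u = a * u + b),
      forall u, 0 <= u < 1 -> 0 < f u,
      forall u w, 0 <= u -> u < w -> w < 1 -> f u < f w &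
      f u @[u --> 1^'-] --> +oo].

Definition continuous_up_to_boundary D v : Prop :=
  {within closure D `*` `[0, +oo[,
    continuous (fun q : (R * R) * R => v q.1.1 q.1.2 q.2)}.

(* The bounds 0 <= v < 1 express that f (v x y t) is defined. *)
Definition dirichlet_solution f D v : Prop :=
  [/\ continuous_up_to_boundary D v,
      forall x y t, D (x, y) -> 0 < t ->
        [/\ 0 <= v x y t < 1, derivable (fun s => v x y s) t 1,
            twice_derivable (fun s => v s y t) x,
            twice_derivable (fun s => v x s t) y &
            d_t v x y t = laplacian v x y t + f (v x y t)],
      forall x y t, boundary D (x, y) -> 0 < t -> v x y t = 0 &
      forall x y, closure D (x, y) -> v x y 0 = 0].

(* Lower solutions need not be smooth in space: the differential inequality is
   required at every point, with the lower Laplacian, which is the classical one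
   wherever v is twice differentiable in x and y. The bounds 0 <= v < 1 express
   that f (v x y t) is defined. *)
Definition lower_solution f Om v : Prop :=
  [/\ continuous_up_to_boundary Om v,
      forall x y t, Om (x, y) -> 0 < t ->
        [/\ 0 <= v x y t < 1, derivable (fun s => v x y s) t 1 &
            ((d_t v x y t)%:E
               <= lower_laplacian v x y t + (f (v x y t))%:E)%E],
      forall x y t, boundary Om (x, y) -> 0 < t -> v x y t <= 0 &
      forall x y, closure Om (x, y) -> v x y 0 <= 0].

Definition extension_by_zero D v : R -> R -> R -> R :=
  fun x y t => if (x, y) \in D then v x y t else 0.

End Problem.

(* Main.v *)
(* Inside the rectangle the extension v coincides locally with v1, which solves
   the equation classically. At any other point of Om, v vanishes at all times,
   so v_t = 0; as v >= 0 everywhere, such a point is a spatial minimum of v, so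
   the second difference quotients are nonnegative there, and f 0 > 0. On the
   edges of the rectangle this is where the lower Laplacian is needed: v has a
   convex kink. Continuity holds because v1 = 0 on the boundary. *)

Require Import Defs.
From mathcomp Require Import all_boot all_order all_algebra.
From mathcomp Require Import all_classical all_reals all_analysis.

Import Order.TTheory GRing.Theory Num.Theory.
Import numFieldNormedType.Exports.

Local Open Scope ring_scope.
Local Open Scope classical_set_scope.

(** Each of the two conditions puts a strict bound on the modulus of a continuous affine
    function. *)
Lemma open_rectangle (R : realType) (c : R * R) (th a b : R) :
  open (rectangle c th a b).
Proof.
have ol (e : R) (F : R * R -> R) : continuous F -> open [set p | `|F p| < e].
  move=> cF.
  apply: (@open_comp _ _ (fun p => `|F p|) [set x | x < e]); last exact: open_lt.
  by move=> p _; apply: cvg_norm; exact: cF.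
have c1 (u : R) : continuous (fun p : R * R => p.1 - u).
  by move=> p; apply: cvgB; [exact: cvg_fst | exact: cvg_cst].
have c2 (u : R) : continuous (fun p : R * R => p.2 - u).
  by move=> p; apply: cvgB; [exact: cvg_snd | exact: cvg_cst].
apply: openI; apply: ol => p; [apply: cvgD | apply: cvgB];
  by apply: cvgMl_tmp; (exact: (c1 c.1) || exact: (c2 c.2)).
Qed.

Lemma closed_setX (T U : topologicalType) (A : set T) (B : set U) :
  closed A -> closed B -> closed (A `*` B).
Proof.
move=> cA cB; rewrite (_ : A `*` B = (fst @^-1` A) `&` (snd @^-1` B))//.
apply: closedI; apply: preimage_closed => // p _;
  [exact: cvg_fst | exact: cvg_snd].
Qed.

(** The lower limit is a supremum, over members [V] of the filter, of infima over [V]. Shrinking [V]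
    to where [g] and [h] agree only raises the infimum; by symmetry one inequality suffices. *)
Lemma near_eq_limf_einf (R : realType) (T : choiceType) (X : filteredType T)
    (F : set_system X) (g h : X -> \bar R) : Filter F ->
  (\forall s \near F, g s = h s) -> limf_einf g F = limf_einf h F.
Proof.
have le (g' h' : X -> \bar R) : Filter F ->
    (\forall s \near F, g' s = h' s) -> (limf_einf g' F <= limf_einf h' F)%E.
  move=> FF gh; rewrite !limf_einfE; apply: ge_ereal_sup => _ [V FV <-].
  apply: (@le_trans _ _ (ereal_inf (h' @` (V `&` [set s | g' s = h' s])))).
    by apply: ereal_inf_le_tmp => _ [s [Vs gs] <-]; exists s.
  by apply: ereal_sup_ubound; exists (V `&` [set s | g' s = h' s]) => //;
    exact: filterI.
move=> FF gh; apply/eqP; rewrite eq_le !le//.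
by apply: filterS gh => s ->.
Qed.

(** For small [s] the difference quotient samples only [x], [x + s] and [x - s], all in the
    neighbourhood of agreement. *)
Lemma near_eq_lower_derive2 (R : realType) (g h : R -> R) (x : R) :
  (\forall s \near x, g s = h s) -> lower_derive2 g x = lower_derive2 h x.
Proof.
move=> gh; apply: near_eq_limf_einf.
have gx : g x = h x by exact: nbhs_singleton gh.
have cp : x + s @[s --> (0 : R)] --> x.
  rewrite -[X in _ --> X]addr0; apply: cvgD; [exact: cvg_cst | exact: cvg_id].
have cm : x - s @[s --> (0 : R)] --> x.
  rewrite -[X in _ --> X]subr0; apply: cvgB; [exact: cvg_cst | exact: cvg_id].
have gp : \forall s \near (0 : R), g (x + s) = h (x + s) by exact: cp gh.
have gm : \forall s \near (0 : R), g (x - s) = h (x - s) by exact: cm gh.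
apply: nbhs_dnbhs; apply: filterS2 gp gm => s gp gm.
by rewrite gx gp gm.
Qed.

Lemma lower_derive2_ge0 (R : realType) (g : R -> R) (x : R) :
  (forall s, 0 <= g s) -> g x = 0 -> (0 <= lower_derive2 g x)%E.
Proof.
move=> g0 gx; apply: lime_inf_ge0 => h.
by rewrite lee_fin gx mulr0 subr0 divr_ge0 ?addr_ge0// sqr_ge0.
Qed.

Section ExtensionByZero.
Context {R : realType} {f : R -> R} {D : set (R * R)} {v : R -> R -> R -> R}.
Hypotheses (oD : open D) (hv : dirichlet_solution f D v).

Let w := extension_by_zero D v.

Lemma extension_by_zero_in x y t : D (x, y) -> w x y t = v x y t.
Proof. by move=> Dxy; rewrite /w /extension_by_zero mem_set. Qed.

Lemma extension_by_zero_notin x y t : ~ D (x, y) -> w x y t = 0.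
Proof. by move=> Dxy; rewrite /w /extension_by_zero memNset. Qed.

(** As [D] is open, the points of its closure outside [D] are boundary points. There [v] vanishes by
    the boundary condition for [t > 0] and by the initial condition at [t = 0]. *)
Lemma extension_by_zero_closure x y t :
  closure D (x, y) -> 0 <= t -> w x y t = v x y t.
Proof.
case: hv => _ _ vb v0 cD t0; have [Dxy|nD] := pselect (D (x, y)).
  exact: extension_by_zero_in.
rewrite extension_by_zero_notin//; move: t0; rewrite le_eqVlt.
move=> /predU1P[<-|t0]; first by rewrite v0.
by rewrite vb// /boundary ((interior_id D).1 oD).
Qed.

Lemma extension_by_zero_ge0 x y t : 0 < t -> 0 <= w x y t.
Proof.
case: hv => _ vD _ _ t0; have [Dxy|nD] := pselect (D (x, y)).
  by rewrite extension_by_zero_in//; have [/andP[]] := vD x y t Dxy t0.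
by rewrite extension_by_zero_notin.
Qed.

(** Pasting on two closed sets, over the closure of [D] and over the complement of [D]: [w] equals
    [v] on the first and 0 on the second. Together they cover the whole plane, whence the arbitrary
    [A]. *)
Lemma continuous_extension_by_zero (A : set (R * R)) :
  continuous_up_to_boundary A w.
Proof.
pose I : set R := `[0, +oo[.
have cI : closed I by exact: interval_closed.
apply: (@continuous_subspaceW _ _ _
    ((closure D `*` I) `|` (~` D `*` I))).
  move=> [p t] [_ It] /=; have [Dp|nDp] := pselect (D p).
    by left; split => //; exact: subset_closure.
  by right.
apply: withinU_continuous.
- by apply: closed_setX => //; exact: closed_closure.
- by apply: closed_setX => //; exact: open_closedC.
- case: hv => vc _ _ _; move: vc; apply: subspace_eq_continuous.
  move=> [[x y] t]; rewrite inE => -[/= cD].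
  rewrite in_itv/= andbT => t0.
  by rewrite /from_subspace extension_by_zero_closure.
- apply: (@subspace_eq_continuous _ _ _ (cst 0)); last exact: cst_continuous.
  move=> [[x y] t]; rewrite inE => -[/= nD _].
  by rewrite /from_subspace extension_by_zero_notin.
Qed.

Lemma lower_laplacian_extension_by_zero_in x y t : D (x, y) ->
  lower_laplacian w x y t = lower_laplacian v x y t.
Proof.
move=> Dxy; have nD : nbhs (x, y) D by exact: open_nbhs_nbhs.
rewrite /lower_laplacian; congr (_ + _)%E; apply: near_eq_lower_derive2.
- have c : (s, y) @[s --> x] --> (x, y).
    by apply: (@cvg_pair _ _ _ _ (nbhs x) (nbhs y)); [exact: cvg_id | exact: cvg_cst].
  have Ds : \forall s \near x, D (s, y) by exact: c nD.
  by apply: filterS Ds => s; exact: extension_by_zero_in.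
- have c : (x, s) @[s --> y] --> (x, y).
    by apply: (@cvg_pair _ _ _ _ (nbhs x) (nbhs y)); [exact: cvg_cst | exact: cvg_id].
  have Ds : \forall s \near y, D (x, s) by exact: c nD.
  by apply: filterS Ds => s; exact: extension_by_zero_in.
Qed.

Lemma lower_solution_extension_by_zero (Om : set (R * R)) :
  0 <= f 0 -> open Om -> D `<=` Om -> lower_solution f Om w.
Proof.
move=> f0 oOm DOm; case: (hv) => _ vD _ v0; split.
- exact: continuous_extension_by_zero.
- move=> x y t _ t0; have [Dxy|nD] := pselect (D (x, y)).
    have [vb dv vx vy ve] := vD x y t Dxy t0.
    (* Membership in [D] does not involve time, so the two functions agree for all [s] and so do
       their time derivatives. *)
    have wE : (fun s => w x y s) = (fun s => v x y s).
      by apply/funext => s; rewrite extension_by_zero_in.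
    rewrite lower_laplacian_extension_by_zero_in// (lower_laplacianE vx vy).
    by rewrite /d_t wE extension_by_zero_in// -EFinD lee_fin -/(d_t v x y t) ve.
  have wE : (fun s => w x y s) = cst 0.
    by apply/funext => s; rewrite extension_by_zero_notin.
  rewrite /d_t wE extension_by_zero_notin// lexx ltr01; split => //.
  (* Both lower second derivatives are nonnegative, so the indeterminate sum of opposite infinities
     cannot occur. *)
  rewrite derive1_cst adde_ge0 ?lee_fin// adde_ge0// lower_derive2_ge0//;
    by [move=> s; exact: extension_by_zero_ge0 | exact: extension_by_zero_notin].
(* A boundary point of the open set [Om] lies outside [Om], hence outside [D]. *)
- move=> x y t [_ nOm] _; rewrite extension_by_zero_notin// => /DOm.
  by rewrite ((interior_id Om).1 oOm) in nOm.
- move=> x y _; have [Dxy|nD] := pselect (D (x, y)).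
    by rewrite extension_by_zero_in// v0//; exact: subset_closure.
  by rewrite extension_by_zero_notin.
Qed.

End ExtensionByZero.

Theorem theorem1 (R : realType) (f : R -> R) (Om Rect : set (R * R))
    (v1 : R -> R -> R -> R)
    (hf : reaction_term f)
    (hOm : domain Om)
    (hbd : piecewise_smooth_boundary Om)
    (hRect : maximal_rectangle Om Rect)
    (hv1 : dirichlet_solution f Rect v1) :
  lower_solution f Om (extension_by_zero Rect v1).
Proof.
case: hRect => c [th [a [b [_ _ RectE RectOm _]]]].
case: hf => _ f_gt0 _ _; case: hOm => oOm _ _.
apply: lower_solution_extension_by_zero => //.
  by rewrite RectE; exact: open_rectangle.
by rewrite ltW// f_gt0// lexx ltr01.
Qed.
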